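(* Let $(A,\circ)$ be an anti-pre-Lie algebra and let $r=\sum_i a_i\otimes b_i\in A\otimes A$ be skew-symmetric, i.e. $\tau(r)=-r$. If $\mathbf T(r)=0$, then $(A,\circ,\delta)$ is an anti-pre-Lie bialgebra, where $\delta=\delta_r:A\to A\otimes A$ is defined by $$\delta_r(x)=\big(-\mathcal L_\circ(x)\otimes\mathrm{id}+\mathrm{id}\otimes\mathrm{ad}(x)\big)r,\qquad x\in A.$$
   Context: All vector spaces and algebras are finite-dimensional over an algebraically closed field $\mathbb K$ of characteristic zero. Anti-pre-Lie algebra: a vector space $A$ with a bilinear operation $\circ$ such that, with $[x,y]=x\circ y-y\circ x$, for all $x,y,z$: $x\circ(y\circ z)-y\circ(x\circ z)=[y,x]\circ z$ and $[x,y]\circ z+[y,z]\circ x+[z,x]\circ y=0$. Notation: $\mathcal L_\circ(x)y=x\circ y=\mathcal R_\circ(y)x$, $\mathrm{ad}(x)y=[x,y]$; $\tau(x\otimes y)=y\otimes x$, $\xi(x\otimes y\otimes z)=y\otimes z\otimes x$. For $r=\sum_i a_i\otimes b_i$: $\mathbf T(r)=\sum_{i,j}\big(a_i\circ a_j\otimes b_i\otimes b_j+a_i\otimes b_i\circ a_j\otimes b_j-a_i\otimes a_j\otimes[b_i,b_j]\big)$. (The equation $\mathbf T(r)=0$ is the anti-pre-Lie Yang-Baxter equation, APL-YBE.) An anti-pre-Lie coalgebra $(A,\delta)$ is a vector space with a linear map $\delta:A\to A\otimes A$ satisfying $(\mathrm{id}^{\otimes3}-\tau\otimes\mathrm{id})(\mathrm{id}\otimes\delta)\delta=(\tau\otimes\mathrm{id}-\mathrm{id}^{\otimes3})(\delta\otimes\mathrm{id})\delta$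 and $(\mathrm{id}^{\otimes3}+\xi+\xi^2)(\tau\otimes\mathrm{id}-\mathrm{id}^{\otimes3})(\delta\otimes\mathrm{id})\delta=0$. An anti-pre-Lie bialgebra $(A,\circ,\delta)$ consists of an anti-pre-Lie algebra $(A,\circ)$ and an anti-pre-Lie coalgebra $(A,\delta)$ such that for all $x,y\in A$: $(\mathrm{id}^{\otimes2}-\tau)\Big(\delta(x\circ y)-(\mathcal L_\circ(x)\otimes\mathrm{id})\delta(y)-(\mathrm{id}\otimes\mathcal L_\circ(x))\delta(y)+(\mathrm{id}\otimes\mathcal R_\circ(y))\delta(x)\Big)=0$, $\delta([x,y])=(\mathrm{id}\otimes\mathrm{ad}(x)-\mathcal L_\circ(x)\otimes\mathrm{id})\delta(y)-(\mathrm{id}\otimes\mathrm{ad}(y)-\mathcal L_\circ(y)\otimes\mathrm{id})\delta(x)$. *)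

(* Defs.v *)
From HB Require Import structures.
From mathcomp Require Import all_boot all_order all_algebra.

Set Implicit Arguments.
Unset Strict Implicit.
Unset Printing Implicit Defensive.

Import GRing.Theory.
Local Open Scope ring_scope.

(* The tensor product of two finite-dimensional spaces, by coordinates in the *)
(* bases vbasis fullv. It is bilinear (tens_bilinear) and universal: tlift f  *)
(* is the linear map induced by a bilinear f (tlift_linear, tlift_tens), and  *)
(* it is the only one (tensor_ext).                                           *)
Definition tensor (K : fieldType) (U V : vectType K) : vectType K :=
  'M[K]_(\dim {:U}, \dim {:V}).

Definition tens (K : fieldType) (U V : vectType K) (u : U) (v : V) :
  tensor U V :=
  \matrix_(i, j) (coord (vbasis {:U}) i u * coord (vbasis {:V}) j v).

Notation "u \ot v" := (tens u v) (at level 40, left associativity) : ring_scope.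

Definition tlift (K : fieldType) (U V W : vectType K) (f : U -> V -> W)
    (t : tensor U V) : W :=
  \sum_(i < \dim {:U}) \sum_(j < \dim {:V})
    (t : 'M[K]_(_, _)) i j *: f (vbasis {:U})`_i (vbasis {:V})`_j.

Section TensorTheory.

Variable K : fieldType.
Implicit Types U V W : vectType K.

Lemma tens_bilinear U V : bilinear_for *:%R *:%R (@tens K U V).
Proof.
split=> [v k u1 u2 | u k v1 v2]; apply/matrixP => i j; rewrite !mxE linearP /=.
  by rewrite mulrDl mulrA.
by rewrite mulrDr mulrCA.
Qed.

Lemma tlift_linear U V W (f : U -> V -> W) : linear (tlift f).
Proof.
move=> k s t; rewrite /tlift scaler_sumr -big_split; apply: eq_bigr => i _ /=.
rewrite scaler_sumr -big_split; apply: eq_bigr => j _ /=.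
by rewrite !mxE scalerDl scalerA.
Qed.

Lemma tlift_tens U V W (f : U -> V -> W) :
  bilinear_for *:%R *:%R f -> forall u v, tlift f (u \ot v) = f u v.
Proof.
move=> [fl fr] u v.
pose gl w : {linear U -> W} := HB.pack (f^~ w)
  (GRing.isLinear.Build K U W *:%R (f^~ w) (fl w)).
pose gr w : {linear V -> W} := HB.pack (f w)
  (GRing.isLinear.Build K V W *:%R (f w) (fr w)).
rewrite -[RHS]/(gl v u) [in RHS](coord_vbasis (memvf u)) linear_sum /tlift.
apply: eq_bigr => i _; rewrite linearZ /=; set e := (vbasis {:U})`_i.
rewrite -[f e v]/(gr e v).
rewrite [in RHS](coord_vbasis (memvf v)) linear_sum scaler_sumr.
by apply: eq_bigr => j _; rewrite linearZ scalerA !mxE.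
Qed.

Lemma tens_sum U V (t : tensor U V) :
  t = \sum_i \sum_j
        (t : 'M[K]_(_, _)) i j *: ((vbasis {:U})`_i \ot (vbasis {:V})`_j).
Proof.
rewrite {1}[t]matrix_sum_delta; apply: eq_bigr => i _; apply: eq_bigr => j _.
congr (_ *: _); apply/matrixP => i' j'.
rewrite !mxE !coord_free ?(basis_free (vbasisP _)) // -natrM mulnb.
by rewrite [i == _]eq_sym [j == _]eq_sym.
Qed.

Lemma tensor_ext U V W (f g : {linear tensor U V -> W}) :
  (forall u v, f (u \ot v) = g (u \ot v)) -> f =1 g.
Proof.
move=> efg t; rewrite [t]tens_sum !linear_sum; apply: eq_bigr => i _.
by rewrite !linear_sum; apply: eq_bigr => j _; rewrite !linearZ efg.
Qed.

End TensorTheory.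

(* f (x) g *)
Definition tmap (K : fieldType) (U V U' V' : vectType K)
    (f : U -> U') (g : V -> V') : tensor U V -> tensor U' V' :=
  tlift (fun u v => f u \ot g v).

Definition tflip (K : fieldType) (U V : vectType K) :
    tensor U V -> tensor V U :=
  tlift (fun u v => v \ot u).

(* Triple tensors are bracketed to the left; tassoc is the canonical          *)
(* identification U (x) (V (x) W) = (U (x) V) (x) W.                          *)
Definition tassoc (K : fieldType) (U V W : vectType K) :
    tensor U (tensor V W) -> tensor (tensor U V) W :=
  tlift (fun u => tlift (fun v w => u \ot v \ot w)).

(* x (x) y (x) z |-> y (x) z (x) x *)
Definition trot (K : fieldType) (A : vectType K) :
    tensor (tensor A A) A -> tensor (tensor A A) A :=
  tlift (fun t z => tlift (fun x y => y \ot z \ot x) t).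

Section AntiPreLie.

Variables (K : fieldType) (A : vectType K).
Implicit Types (mul : A -> A -> A) (delta : A -> tensor A A).

Definition Lmul mul (x y : A) : A := mul x y.
Definition Rmul mul (x y : A) : A := mul y x.
Definition comm mul (x y : A) : A := mul x y - mul y x.

Record anti_pre_lie_algebra mul : Prop := AntiPreLieAlgebra {
  apl_bilinear : bilinear_for *:%R *:%R mul;
  apl_left : forall x y z,
    mul x (mul y z) - mul y (mul x z) = mul (comm mul y x) z;
  apl_cyclic : forall x y z,
    mul (comm mul x y) z + mul (comm mul y z) x + mul (comm mul z x) y = 0
}.

(* (tau (x) id - id) (delta (x) id) delta *)
Definition coalg_rhs delta (x : A) : tensor (tensor A A) A :=
  let u := tmap delta id (delta x) in tmap (@tflip K A A) id u - u.

(* (id - tau (x) id) (id (x) delta) delta *)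
Definition coalg_lhs delta (x : A) : tensor (tensor A A) A :=
  let u := tassoc (tmap id delta (delta x)) in u - tmap (@tflip K A A) id u.

Record anti_pre_lie_coalgebra delta : Prop := AntiPreLieCoalgebra {
  aplc_linear : linear delta;
  aplc_left : forall x, coalg_lhs delta x = coalg_rhs delta x;
  aplc_cyclic : forall x, let t := coalg_rhs delta x in
    t + trot t + trot (trot t) = 0
}.

Record anti_pre_lie_bialgebra mul delta : Prop := AntiPreLieBialgebra {
  aplb_algebra : anti_pre_lie_algebra mul;
  aplb_coalgebra : anti_pre_lie_coalgebra delta;
  aplb_mul : forall x y,
    let t := delta (mul x y) - tmap (Lmul mul x) id (delta y)
             - tmap id (Lmul mul x) (delta y)
             + tmap id (Rmul mul y) (delta x) in
    t - tflip t = 0;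
  aplb_comm : forall x y,
    delta (comm mul x y) =
      (tmap id (comm mul x) (delta y) - tmap (Lmul mul x) id (delta y))
      - (tmap id (comm mul y) (delta x) - tmap (Lmul mul y) id (delta x))
}.

(* T(r) for r = \sum_i a i \ot b i *)
Definition APL_YB mul (n : nat) (a b : 'I_n -> A) : tensor (tensor A A) A :=
  \sum_i \sum_j (mul (a i) (a j) \ot b i \ot b j
                 + a i \ot mul (b i) (a j) \ot b j
                 - a i \ot a j \ot comm mul (b i) (b j)).

Definition delta_r mul (r : tensor A A) (x : A) : tensor A A :=
  - tmap (Lmul mul x) id r + tmap id (comm mul x) r.

End AntiPreLie.

(* Main.v *)
(**
  A skew-symmetric [r] gives a map [P : A* -> A], [P f = (f (x) id) r], with
  [f (P g) = - g (P f)].  The transpose of [delta_r] is the product on [A*]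
    [(f * g) x = f (x o P g) + g [x, P f]],
  and pairing [T(r)] with [f (x) h (x) g] shows that [T(r) = 0] means
  [P (f * g) = - P f o P g].  The coalgebra axioms for [delta_r] say that
  [( A*, * )] is an anti-pre-Lie algebra; once [P (f * g)] is replaced, the
  coefficients of [f], [g] and [h] are consequences of the axioms of [A].  The
  bialgebra compatibilities hold for every skew-symmetric [r]: the last one
  because [delta_r] is a coboundary for the representation [(-L) (x) ad] of the
  Lie algebra of [A].
*)
From HB Require Import structures.
Require Import Defs.
From mathcomp Require Import all_boot all_order all_algebra.
From mathcomp Require Import ring.
Import GRing.Theory.
Local Open Scope ring_scope.

Set Implicit Arguments.
Unset Strict Implicit.
Unset Printing Implicit Defensive.

(** * Separating tensors by pairs and triples of functionals *)

Section Pairing.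

Variable K : fieldType.
Implicit Types U V W : vectType K.

HB.instance Definition _ U V W (f : U -> V -> W) :=
  GRing.isLinear.Build K (tensor U V) W *:%R (tlift f) (tlift_linear f).

HB.instance Definition _ U V U' V' (f : U -> U') (g : V -> V') :=
  GRing.Linear.on (tmap f g).

HB.instance Definition _ U V := GRing.Linear.on (@tflip K U V).

HB.instance Definition _ U V W := GRing.Linear.on (@tassoc K U V W).

HB.instance Definition _ U := GRing.Linear.on (@trot K U).

(** [tlift] wants a [vectType] as target, hence [K^o]. The instance below restates linearity with
    [*%R], so that a pairing is itself a scalar form and can be paired again on triple tensors. *)
Definition pairing U V (f : U -> K) (g : V -> K) : tensor U V -> K :=
  tlift (fun u v => f u * g v : K^o).

HB.instance Definition _ U V (f : U -> K) (g : V -> K) :=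
  GRing.isLinear.Build K (tensor U V) K *%R (pairing f g)
    (tlift_linear (fun u v => f u * g v : K^o)).

Lemma tens_scalar_ext U V (f g : {scalar tensor U V}) :
  (forall u v, f (u \ot v) = g (u \ot v)) -> f =1 g.
Proof.
move=> efg t; rewrite [t]tens_sum !linear_sum; apply: eq_bigr => i _.
by rewrite !linear_sum; apply: eq_bigr => j _; rewrite !linearZ efg.
Qed.

Lemma pairing_tens U V (f : {scalar U}) (g : {scalar V}) u v :
  pairing f g (u \ot v) = f u * g v.
Proof.
rewrite /pairing tlift_tens //; split=> [w k u1 u2 | w k v1 v2] /=.
  by rewrite linearP mulrDl -mulrA.
by rewrite linearP mulrDr mulrCA.
Qed.

Lemma tmap_tens U V U' V' (f : {linear U -> U'}) (g : {linear V -> V'}) u v :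
  tmap f g (u \ot v) = f u \ot g v.
Proof.
have [tl tr] := tens_bilinear U' V'.
rewrite /tmap tlift_tens //; split=> [w k u1 u2 | w k v1 v2] /=.
  by rewrite linearP tl.
by rewrite linearP tr.
Qed.

Lemma tflip_tens U V (u : U) (v : V) : tflip (u \ot v) = v \ot u.
Proof.
have [tl tr] := tens_bilinear V U.
by rewrite /tflip tlift_tens.
Qed.

Lemma tassoc_tens U V W (u : U) (v : V) (w : W) :
  tassoc (u \ot (v \ot w)) = u \ot v \ot w.
Proof.
have [tl tr] := tens_bilinear (tensor U V) W.
have [tl' tr'] := tens_bilinear U V.
have bil (z : U) : bilinear_for *:%R *:%R
    (fun (v : V) (w : W) => z \ot v \ot w).
  split=> [x k u1 u2 | x k v1 v2] /=; last exact: tr.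
  by rewrite tr' tl.
rewrite /tassoc tlift_tens ?tlift_tens //.
split=> [x k u1 u2 | x k v1 v2] /=; last exact: linearP.
(* Here linearity is in the lifted function, not in the tensor; it is read off the coordinate sum
   defining [tlift]. *)
rewrite /tlift scaler_sumr -big_split; apply: eq_bigr => i _ /=.
rewrite scaler_sumr -big_split; apply: eq_bigr => j _ /=.
by rewrite tl' tl scalerDr !scalerA [k * _]mulrC.
Qed.

Lemma trot_tens U (x y z : U) : trot (x \ot y \ot z) = y \ot z \ot x.
Proof.
have [tl tr] := tens_bilinear (tensor U U) U.
have [tl' tr'] := tens_bilinear U U.
have bil (w : U) : bilinear_for *:%R *:%R (fun x y : U => y \ot w \ot x).
  split=> [v k u1 u2 | v k v1 v2] /=; first exact: tr.
  by rewrite tl' tl.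
rewrite /trot tlift_tens ?tlift_tens //.
split=> [v k u1 u2 | v k v1 v2] /=; first exact: linearP.
rewrite /tlift scaler_sumr -big_split; apply: eq_bigr => i _ /=.
rewrite scaler_sumr -big_split; apply: eq_bigr => j _ /=.
by rewrite tr' tl scalerDr !scalerA [k * _]mulrC.
Qed.

Lemma pairing_tmap U V U' V' (f : {linear U -> U'}) (g : {linear V -> V'})
    (p : {scalar U'}) (q : {scalar V'}) t :
  pairing p q (tmap f g t) = pairing (p \o f) (q \o g) t.
Proof.
apply: (tens_scalar_ext (f := pairing p q \o tmap f g)) => u v /=.
by rewrite tmap_tens !pairing_tens.
Qed.

Lemma pairing_tflip U V (p : {scalar V}) (q : {scalar U}) t :
  pairing p q (tflip t) = pairing q p t.
Proof.
apply: (tens_scalar_ext (f := pairing p q \o @tflip K U V)) => u v /=.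
by rewrite tflip_tens !pairing_tens mulrC.
Qed.

Lemma tens3_scalar_ext U V W (f g : {scalar tensor (tensor U V) W}) :
  (forall u v w, f (u \ot v \ot w) = g (u \ot v \ot w)) -> f =1 g.
Proof.
move=> efg; apply: tens_scalar_ext => t w.
have [tl _] := tens_bilinear (tensor U V) W.
(* With [w] fixed, tensoring by it is linear, so extensionality applies once more to the inner
   factor. *)
pose tw : {linear tensor U V -> tensor (tensor U V) W} :=
  HB.pack (fun t => t \ot w)
    (GRing.isLinear.Build K _ _ *:%R (fun t => t \ot w) (tl w)).
exact: (tens_scalar_ext (f := f \o tw) (g := g \o tw) (fun u v => efg u v w)).
Qed.

Lemma pairing_tassoc U V W (f : {scalar U}) (g : {scalar V})
    (h : {scalar W}) t :
  pairing (pairing f g) h (tassoc t) = pairing f (pairing g h) t.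
Proof.
apply: (tens_scalar_ext (f := pairing (pairing f g) h \o @tassoc K U V W))
  => u s /=.
have [_ tr] := tens_bilinear U (tensor V W).
pose tu : {linear tensor V W -> tensor U (tensor V W)} := HB.pack (tens u)
  (GRing.isLinear.Build K _ _ *:%R (tens u) (tr u)).
apply: (tens_scalar_ext
  (f := pairing (pairing f g) h \o @tassoc K U V W \o tu)
  (g := pairing f (pairing g h) \o tu)) => v w /=.
by rewrite tassoc_tens !pairing_tens /= !pairing_tens mulrA.
Qed.

Lemma pairing_trot U (f g h : {scalar U}) t :
  pairing (pairing f g) h (trot t) = pairing (pairing h f) g t.
Proof.
apply: (tens3_scalar_ext (f := pairing (pairing f g) h \o @trot K U))
  => u v w /=.
by rewrite trot_tens !pairing_tens /= !pairing_tens; ring.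
Qed.

Definition contract U V (f : U -> K) : tensor U V -> V :=
  tlift (fun u v => f u *: v).

Lemma contract_tens U V (f : {scalar U}) u (v : V) :
  contract f (u \ot v) = f u *: v.
Proof.
rewrite /contract tlift_tens //; split=> [w k u1 u2 | w k v1 v2] /=.
  by rewrite linearP scalerDl scalerA.
by rewrite scalerDr !scalerA mulrC.
Qed.

Lemma pairing_contract U V (f : {scalar U}) (g : {scalar V}) t :
  pairing f g t = g (contract f t).
Proof.
apply: (tens_scalar_ext (g := g \o tlift (fun u v => f u *: v))) => u v /=.
by rewrite -/(contract f _) contract_tens pairing_tens linearZ.
Qed.

Lemma scalar_sep U (x y : U) : (forall f : {scalar U}, f x = f y) -> x = y.
Proof.
move=> fxy; rewrite [x](coord_vbasis (memvf x)) [y](coord_vbasis (memvf y)).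
by apply: eq_bigr => i _; rewrite (fxy (coord (vbasis {:U}) i)).
Qed.

(** Pairing with two coordinate forms gives a matrix entry. *)
Lemma pairing_sep U V (s t : tensor U V) :
  (forall (f : {scalar U}) (g : {scalar V}), pairing f g s = pairing f g t) ->
  s = t.
Proof.
have entry (z : tensor U V) i j : (z : 'M_(_, _)) i j
    = pairing (coord (vbasis {:U}) i) (coord (vbasis {:V}) j) z.
  rewrite {1}[z]tens_sum {2}[z]tens_sum summxE linear_sum.
  apply: eq_bigr => k _; rewrite summxE linear_sum; apply: eq_bigr => l _.
  by rewrite linearZ /= pairing_tens !mxE.
by move=> est; apply/matrixP => i j; rewrite !entry est.
Qed.

Lemma pairing3_sep U V W (s t : tensor (tensor U V) W) :
  (forall (f : {scalar U}) (g : {scalar V}) (h : {scalar W}),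
    pairing (pairing f g) h s = pairing (pairing f g) h t) -> s = t.
Proof.
move=> est; apply: pairing_sep => p h.
(* The functional [p] on [tensor U V] need not be a pairing. After the flip, [h] is contracted first
   and [p] acts on a double tensor, so it suffices to separate these contractions. *)
rewrite -[LHS]pairing_tflip -[RHS]pairing_tflip !pairing_contract.
congr (p _); apply: pairing_sep => f g.
by rewrite -!(pairing_contract h (pairing f g)) !pairing_tflip; apply: est.
Qed.

(** [idfun] is the form of [id] that carries a linear structure; the two are convertible. *)
Lemma pairing_tmapl U V U' (f : {linear U -> U'}) (p : {scalar U'})
    (q : {scalar V}) t : pairing p q (tmap f id t) = pairing (p \o f) q t.
Proof. exact: (pairing_tmap f idfun). Qed.

Lemma pairing_tmapr U V V' (g : {linear V -> V'}) (p : {scalar U})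
    (q : {scalar V'}) t : pairing p q (tmap id g t) = pairing p (q \o g) t.
Proof. exact: (pairing_tmap idfun g). Qed.

Lemma pairing_tmap_tflip U V W (f : {scalar V}) (g : {scalar U})
    (h : {scalar W}) (t : tensor (tensor U V) W) :
  pairing (pairing f g) h (tmap (@tflip K U V) id t) =
  pairing (pairing g f) h t.
Proof.
rewrite pairing_tmapl.
apply: tens_scalar_ext => s w /=; rewrite !pairing_tens /=.
by rewrite pairing_tflip.
Qed.

(** Trades a contraction of the second slot for one of the first, at the cost of a sign, so that a
    single map [P] suffices. *)
Lemma pairing_skew U (r : tensor U U) (f g : {scalar U}) :
  tflip r = - r -> pairing f g r = - f (contract g r).
Proof.
move=> sk; rewrite -pairing_contract -(pairing_tflip f g) sk.
by rewrite linearN opprK.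
Qed.

Lemma bilinear_sum U V W (m : U -> V -> W) n (c d : 'I_n -> K)
    (u : 'I_n -> U) (v : 'I_n -> V) :
  bilinear_for *:%R *:%R m ->
  m (\sum_i c i *: u i) (\sum_j d j *: v j) =
  \sum_i \sum_j (c i * d j) *: m (u i) (v j).
Proof.
move=> [ml mr].
pose m1 w : {linear U -> W} := HB.pack (m^~ w)
  (GRing.isLinear.Build K U W *:%R (m^~ w) (ml w)).
pose m2 w : {linear V -> W} := HB.pack (m w)
  (GRing.isLinear.Build K V W *:%R (m w) (mr w)).
rewrite -[LHS]/(m1 _ _) linear_sum; apply: eq_bigr => i _.
rewrite linearZ /= -[m (u i) _]/(m2 (u i) _) linear_sum scaler_sumr.
by apply: eq_bigr => j _; rewrite linearZ scalerA.
Qed.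

End Pairing.

(** * The product on the dual of [A], and [APL_YB] as an identity for [P] *)

Section Coboundary.

Variables (K : fieldType) (A : vectType K) (mul : A -> A -> A).
Hypothesis aplA : anti_pre_lie_algebra mul.

Let mul_bil := apl_bilinear aplA.

HB.instance Definition _ x :=
  GRing.isLinear.Build K A A *:%R (Lmul mul x) (mul_bil.2 x).

HB.instance Definition _ x :=
  GRing.isLinear.Build K A A *:%R (Rmul mul x) (mul_bil.1 x).

Lemma mulBl x y z : mul (x - y) z = mul x z - mul y z.
Proof. exact: (linearB (Rmul mul z)). Qed.

Lemma mulBr x y z : mul z (x - y) = mul z x - mul z y.
Proof. exact: (linearB (Lmul mul z)). Qed.

Lemma mulNl x y : mul (- x) y = - mul x y.
Proof. exact: (linearN (Rmul mul y)). Qed.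

Lemma mulNr x y : mul x (- y) = - mul x y.
Proof. exact: (linearN (Lmul mul x)). Qed.

Lemma comm_bilinear : bilinear_for *:%R *:%R (comm mul).
Proof.
split=> [z k x y | z k x y]; rewrite /= /comm mul_bil.1 mul_bil.2 scalerBr;
  by rewrite opprD addrACA.
Qed.

HB.instance Definition _ x :=
  GRing.isLinear.Build K A A *:%R (comm mul x) (comm_bilinear.2 x).

Variable r : tensor A A.
Hypothesis r_skew : tflip r = - r.

Let P f := contract f r.

Lemma pairing_delta (f g : {scalar A}) x :
  pairing f g (delta_r mul r x) = f (mul x (P g)) + g (comm mul x (P f)).
Proof.
rewrite /delta_r linearD linearN /= pairing_tmapl pairing_tmapr.
by rewrite pairing_skew // opprK pairing_contract.
Qed.

Lemma delta_r_linear : linear (delta_r mul r).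
Proof.
move=> k x y; apply: pairing_sep => f g.
rewrite linearP /= !pairing_delta mul_bil.1 linearP.
rewrite /comm mul_bil.1 mul_bil.2 !linearB !linearP /=.
by ring.
Qed.

HB.instance Definition _ :=
  GRing.isLinear.Build K A (tensor A A) *:%R (delta_r mul r) delta_r_linear.

Lemma pairing_APL_YB n (a b : 'I_n -> A) (f g h : {scalar A}) :
  r = \sum_i a i \ot b i ->
  pairing (pairing f g) h (APL_YB mul a b) =
  f (mul (P g) (P h)) - g (mul (P f) (P h)) - h (comm mul (P f) (P g)).
Proof.
move=> rE.
have PE (p : {scalar A}) : P p = \sum_i p (a i) *: b i.
  rewrite /P rE /contract linear_sum; apply: eq_bigr => i _.
  exact: contract_tens.
(* Skew-symmetry enters here: evaluating the [b i] instead of the [a i] yields [- P]. *)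
have PN (p : {scalar A}) : \sum_i p (b i) *: a i = - P p.
  apply: scalar_sep => q; rewrite linearN /= -pairing_skew // rE !linear_sum.
  by apply: eq_bigr => i _; rewrite /= pairing_tens linearZ /= mulrC.
(* Signs are placed so that each factor [a i] left unevaluated in [APL_YB] comes from a [- P]: two
   in the first term, one in the second, none in the third. *)
have -> : mul (P g) (P h) = mul (- P g) (- P h) by rewrite mulNl mulNr opprK.
have -> : - g (mul (P f) (P h)) = g (mul (P f) (- P h)).
  by rewrite mulNr linearN.
rewrite -!PN !PE.
rewrite !bilinear_sum //; last exact: comm_bilinear.
rewrite /APL_YB !linear_sum -!big_split -sumrB; apply: eq_bigr => i _ /=.
rewrite !linear_sum -!big_split -sumrB; apply: eq_bigr => j _ /=.
by rewrite linearB linearD /= !pairing_tens /= !pairing_tens !linearZ /=; ring.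
Qed.

(** * The coalgebra axioms, from the paired form of [APL_YB mul a b = 0] *)

Hypothesis r_YB : forall f g h : {scalar A},
  f (mul (P g) (P h)) - g (mul (P f) (P h)) - h (comm mul (P f) (P g)) = 0.

Lemma contract_star (f g : {scalar A}) :
  P (pairing f g \o delta_r mul r) = - mul (P f) (P g).
Proof.
apply: scalar_sep => h.
rewrite -pairing_contract pairing_skew //= pairing_delta.
(* The last two functionals are exchanged so that the test functional [h] falls on
   [mul (P f) (P g)]; the next line solves for that value. *)
have /eqP := r_YB f h g; rewrite linearN /comm !linearB /= -/(P h).
by rewrite -(inj_eq (addrI (h (mul (P f) (P g))))) addr0 => /eqP <-; ring.
Qed.

(** In the dual product this is [(g * f - f * g) * h] at [x], which enters both coalgebra axioms. *)
Lemma pairing_coalg_rhs (f g h : {scalar A}) x :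
  pairing (pairing f g) h (coalg_rhs (delta_r mul r) x) =
  g (mul (P f) (mul x (P h))) - f (mul (P g) (mul x (P h)))
  + h (comm mul x (comm mul (P f) (P g))).
Proof.
rewrite /coalg_rhs linearB /= pairing_tmap_tflip !pairing_tmapl.
rewrite !pairing_delta !contract_star /= !pairing_delta -/P.
rewrite /comm !(mulNl, mulNr, mulBl, mulBr) !linearB /= !linearN /=.
by ring.
Qed.

(* The axioms of [A] under a functional [f], as expressions that [ring] can
   combine. *)
Let left_defect (f : A -> K) x y z :=
  f (mul x (mul y z)) - f (mul y (mul x z))
  - (f (mul (mul y x) z) - f (mul (mul x y) z)).

Let cyclic_defect (f : A -> K) x y z :=
  f (mul (mul x y) z) - f (mul (mul y x) z)
  + (f (mul (mul y z) x) - f (mul (mul z y) x))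
  + (f (mul (mul z x) y) - f (mul (mul x z) y)).

Lemma left_defect0 (f : {scalar A}) x y z : left_defect f x y z = 0.
Proof.
by rewrite /left_defect -!linearB -mulBl -(apl_left aplA) subrr linear0.
Qed.

Lemma cyclic_defect0 (f : {scalar A}) x y z : cyclic_defect f x y z = 0.
Proof.
rewrite /cyclic_defect -!linearB -!mulBl -!linearD.
by rewrite (apl_cyclic aplA) linear0.
Qed.

Lemma delta_r_coalg_left x :
  coalg_lhs (delta_r mul r) x = coalg_rhs (delta_r mul r) x.
Proof.
apply: pairing3_sep => f g h; apply: subr0_eq.
rewrite pairing_coalg_rhs /coalg_lhs linearB /= pairing_tmap_tflip.
rewrite !pairing_tassoc !pairing_tmapr.
rewrite !pairing_delta !contract_star /= !pairing_delta -/P.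
rewrite /comm !(mulNl, mulNr, mulBl, mulBr) !linearB /= !linearN /=.
(* The coefficients of [g] and [f] are one left identity each. The coefficient of [h] is the Jacobi
   identity for [comm mul] at [x], [P f], [P g], which costs three left identities and two cyclic
   ones. *)
transitivity (left_defect g x (P f) (P h) - left_defect f x (P g) (P h)
  + left_defect h x (P g) (P f) + left_defect h (P f) x (P g)
  + left_defect h (P g) (P f) x + 2 * cyclic_defect h x (P f) (P g)).
  by rewrite /left_defect /cyclic_defect; ring.
by rewrite !left_defect0 cyclic_defect0; ring.
Qed.

Lemma delta_r_coalg_cyclic x (t := coalg_rhs (delta_r mul r) x) :
  t + trot t + trot (trot t) = 0.
Proof.
apply: pairing3_sep => f g h.
rewrite 2!linearD linear0 /= !pairing_trot /= /t !pairing_coalg_rhs.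
rewrite /comm !(mulBl, mulBr) !linearB /=.
(* [trot] permutes the functionals cyclically, so the coefficients of [h], [f] and [g] are rotations
   of one expression: two left identities and one cyclic one. *)
transitivity (
  left_defect h x (P f) (P g) - left_defect h x (P g) (P f)
  + (left_defect f x (P g) (P h) - left_defect f x (P h) (P g))
  + (left_defect g x (P h) (P f) - left_defect g x (P f) (P h))
  - cyclic_defect h x (P f) (P g) - cyclic_defect f x (P g) (P h)
  - cyclic_defect g x (P h) (P f)).
  by rewrite /left_defect /cyclic_defect; ring.
by rewrite !left_defect0 !cyclic_defect0; ring.
Qed.

(** * Compatibility of [delta_r] with the commutator and with the product *)

Lemma pairing_delta_tmap (f g : {scalar A}) x :
  pairing f g (delta_r mul r x) =
  - pairing (f \o Lmul mul x) g r + pairing f (g \o comm mul x) r.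
Proof.
by rewrite /delta_r linearD linearN /= pairing_tmapl pairing_tmapr.
Qed.

Lemma delta_r_cocycle x y :
  delta_r mul r (comm mul x y) =
    (tmap id (comm mul x) (delta_r mul r y)
     - tmap (Lmul mul x) id (delta_r mul r y))
    - (tmap id (comm mul y) (delta_r mul r x)
       - tmap (Lmul mul y) id (delta_r mul r x)).
Proof.
apply: pairing_sep => f g; apply: subr0_eq.
rewrite !linearB /= !(pairing_tmapl, pairing_tmapr) !pairing_delta_tmap.
(* Only pairings with a bare [f] or [g] in one slot are contracted. Those with both slots acted on
   stay opaque and cancel in pairs. *)
rewrite !(pairing_skew _ g) // !(pairing_contract f) /= -/(P f) -/(P g).
rewrite /Lmul /comm !(mulBl, mulBr) !linearB /=.
(* The [f] term says that [-L] is a representation; the [g] terms, that [ad] is one, by the same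
   derivation of Jacobi as above. *)
transitivity (left_defect f x y (P g) - left_defect g x y (P f)
  + left_defect g x (P f) y + left_defect g (P f) y x
  + 2 * cyclic_defect g x y (P f)).
  by rewrite /left_defect /cyclic_defect; ring.
by rewrite !left_defect0 !cyclic_defect0; ring.
Qed.

Lemma delta_r_mul x y
    (t := delta_r mul r (mul x y) - tmap (Lmul mul x) id (delta_r mul r y)
          - tmap id (Lmul mul x) (delta_r mul r y)
          + tmap id (Rmul mul y) (delta_r mul r x)) :
  t - tflip t = 0.
Proof.
apply: pairing_sep => f g.
have tE (p q : {scalar A}) : pairing p q t =
    pairing p q (delta_r mul r (mul x y))
    - pairing p q (tmap (Lmul mul x) id (delta_r mul r y))
    - pairing p q (tmap id (Lmul mul x) (delta_r mul r y))
    + pairing p q (tmap id (Rmul mul y) (delta_r mul r x)).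
  by rewrite /t linearD !linearB.
rewrite linearB linear0 /= pairing_tflip !tE.
rewrite !(pairing_tmapl, pairing_tmapr) !pairing_delta_tmap /=.
(* Pairings with both slots acted on become values at the contractions of [f \o Lmul mul x] and
   [g \o Lmul mul x]. Since [ad y + R y = L y], their total is symmetric in [f] and [g], hence
   killed by subtracting the flip. *)
rewrite !(pairing_skew (f \o Lmul mul y)) //.
rewrite !(pairing_skew (g \o Lmul mul y)) //.
rewrite !(pairing_skew _ g) // !(pairing_skew _ f) // !pairing_contract /=.
rewrite -/(P f) -/(P g) /Rmul /Lmul /comm !(mulBl, mulBr) !linearB /=.
transitivity (left_defect f (P g) x y - left_defect g (P f) x y).
  by rewrite /left_defect; ring.
by rewrite !left_defect0 subrr.
Qed.

End Coboundary.

Theorem corollary2p20 (K : closedFieldType) (charK : [pchar K] =i pred0)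
    (A : vectType K) (mul : A -> A -> A) (n : nat) (a b : 'I_n -> A)
    (r : tensor A A) :
  anti_pre_lie_algebra mul ->
  r = \sum_(i < n) a i \ot b i ->
  tflip r = - r ->
  APL_YB mul a b = 0 ->
  anti_pre_lie_bialgebra mul (delta_r mul r).
Proof.
move=> aplA rE r_skew YB0.
have r_YB (f g h : {scalar A}) :
    f (mul (contract g r) (contract h r))
    - g (mul (contract f r) (contract h r))
    - h (comm mul (contract f r) (contract g r)) = 0.
  by rewrite -(pairing_APL_YB aplA r_skew f g h rE) YB0 linear0.
split=> //; first split.
- exact: delta_r_linear.
- exact: delta_r_coalg_left.
- exact: delta_r_coalg_cyclic.
- exact: delta_r_mul.
- exact: delta_r_cocycle.
Qed.
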